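(* Let $G$ be a topological group with identity $e$. (i) If $\mathcal A(G)\subseteq \mathcal{CB}(G)$, then every $\mathcal A(G)$-interpolation set is discrete (in the subspace topology). (ii) Every $\mathcal{CB}(G)$-interpolation set is an approximable $\mathcal{CB}(G)$-interpolation set, and every $\mathcal{LUC}(G)$-interpolation set is an approximable $\mathcal{LUC}(G)$-interpolation set. (iii) If the underlying topological space of $G$ is normal, then every discrete closed subset of $G$ is an approximable $\mathcal{CB}(G)$-interpolation set. (iv) If $G$ is locally compact, then every finite subset of $G$ is an approximable $C_0(G)$-interpolation set. (v) If $G$ is metrizable, then a subset of $G$ is an approximable $\mathcal{CB}(G)$-interpolation set if and only if it is discrete and closed. (vi) If $G$ is locally compact and metrizable, then a subset of $G$ is an approximable $C_0(G)$-interpolation set if and only if it is finite.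
   Context: Topological groups are Hausdorff. $\mathcal{CB}(G)$ is the algebra of bounded continuous scalar-valued functions on $G$; $C_0(G)$ is the algebra of continuous functions vanishing at infinity; $\mathcal{LUC}(G)$ is the algebra of bounded $f:G\to\mathbb C$ such that for every $\epsilon>0$ there is a neighbourhood $U$ of $e$ with $|f(s)-f(t)|<\epsilon$ whenever $st^{-1}\in U$. Let $\mathcal A(G)$ be a set of bounded scalar-valued functions on $G$. A set $T\subseteq G$ is an $\mathcal A(G)$-interpolation set if every bounded $f:T\to\mathbb C$ extends to a function in $\mathcal A(G)$. It is an approximable $\mathcal A(G)$-interpolation set if it is an $\mathcal A(G)$-interpolation set and for every neighbourhood $U$ of $e$ there are open neighbourhoods $V_1,V_2$ of $e$ with $\overline{V_1}\subseteq V_2\subseteq U$ such that for each $T_1\subseteq T$ there is $h\in\mathcal A(G)$ with $h(V_1T_1)\subseteq\{1\}$ and $h(G\setminus V_2T_1)\subseteq\{0\}$. *)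

(* Defs.v *)
From HB Require Import structures.
From mathcomp Require Import all_boot all_order all_algebra.
From mathcomp Require Import all_classical all_reals all_analysis.
From mathcomp Require Import complex.

Set Implicit Arguments.
Unset Strict Implicit.
Unset Printing Implicit Defensive.

Import Order.TTheory GRing.Theory Num.Theory.
Import numFieldNormedType.Exports.

Local Open Scope classical_set_scope.
Local Open Scope ring_scope.

(* Hausdorffness is not part of the structure. *)
HB.mixin Record isTopologicalGroup G of Group G & Topological G := {
  mulg_continuous : continuous (fun x : G * G => (x.1 * x.2)%g : G);
  invg_continuous : continuous (fun x : G => x^-1%g : G)
}.

#[short(type="topologicalGroupType")]
HB.structure Definition TopologicalGroup :=
  {G of isTopologicalGroup G & Group G & Topological G}.

(* The complex numbers, as a numClosedFieldType: this is the type from which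
   the library infers the topology of the modulus.  The order of this type only
   compares numbers with the same imaginary part, so that [0 < eps] forces
   [eps] to be a positive real, and the norm takes values in the reals. *)
Definition CC (R : realType) : numClosedFieldType := R[i]%C.

Definition metrizable (R : realType) (X : topologicalType) : Prop :=
  exists d : X -> X -> R,
    [/\ forall x y, d x y = 0 <-> x = y,
        forall x y, d x y = d y x,
        forall x y z, d x z <= d x y + d y z &
        forall x, nbhs x =
          filter_from [set eps : R | 0 < eps]
                      (fun eps => [set y | d x y < eps])].

(* [set_type T] carries the subspace topology. *)
Definition discrete_subset (X : topologicalType) (T : set X) : Prop :=
  forall t : set_type T, nbhs t = principal_filter t.

Section FunctionSpaces.
Variables (R : realType) (G : topologicalGroupType).
Implicit Types (f : G -> CC R) (A : set (G -> CC R)) (T : set G).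

Definition CB : set (G -> CC R) :=
  [set f | continuous f /\ bounded_fun f].

Definition C0 : set (G -> CC R) :=
  [set f | continuous f /\
    forall eps : CC R, 0 < eps ->
      exists2 K : set G, compact K & forall x, ~ K x -> `|f x| < eps].

Definition LUC : set (G -> CC R) :=
  [set f | bounded_fun f /\
    forall eps : CC R, 0 < eps ->
      exists2 U : set G, nbhs (1%g : G) U &
        forall s t, U (s * t^-1)%g -> `|f s - f t| < eps].

Definition interpolation_set A T : Prop :=
  forall f : set_type T -> CC R, bounded_fun f ->
    exists2 g, A g & forall t : set_type T, g (set_val t) = f t.

Definition mulset (V T : set G) : set G :=
  [set (v * t)%g | v in V & t in T].

Definition approximable_interpolation_set A T : Prop :=
  interpolation_set A T /\
  forall U : set G, nbhs (1%g : G) U ->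
    exists V1 V2 : set G,
      [/\ open_nbhs (1%g : G) V1, open_nbhs (1%g : G) V2,
          closure V1 `<=` V2, V2 `<=` U &
          forall T1 : set G, T1 `<=` T ->
            exists2 h, A h &
              h @` mulset V1 T1 `<=` [set 1] /\
              h @` (~` mulset V2 T1) `<=` [set 0]].

End FunctionSpaces.

Arguments CB R G : clear implicits.
Arguments C0 R G : clear implicits.
Arguments LUC R G : clear implicits.

(* Main.v *)
(* The approximability condition holds for every subset of G as soon as the
   function algebra contains the right uniformly continuous functions.  Choose
   symmetric open neighbourhoods U_0, U_1, ... of e inside U with
   U_(n+1) U_(n+1) contained in U_n, and form the dyadic products of the
   Birkhoff-Kakutani argument.  They satisfy U_n W_(k/2^n) <= W_((k+1)/2^n), so
   inf {r | x in W_r T} is a right uniformly continuous gauge of the distance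
   from x to T, and truncating it gives the required function; V1 = U_1 and
   V2 = U_0 depend only on U.  In the locally compact case U is shrunk into a
   compact set, which makes the function compactly supported for finite T.

   This leaves interpolation: Tietze's theorem for closed discrete sets,
   bumps for finite sets; and conversely, in a metrizable group, a function
   alternating along a sequence of T that converges outside T has no
   continuous extension. *)

Require Import Defs.
From HB Require Import structures.
From mathcomp Require Import all_boot all_order all_algebra.
From mathcomp Require Import all_classical all_reals all_analysis.
From mathcomp Require Import complex lra zify.

Set Implicit Arguments.
Unset Strict Implicit.
Unset Printing Implicit Defensive.

Import Order.TTheory GRing.Theory Num.Theory.
Import numFieldNormedType.Exports.

Local Open Scope classical_set_scope.

(** * Products and neighbourhoods of the identity in a topological group *)

Lemma cvg_mulg (G : topologicalGroupType) (T : Type) (F : set_system T)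
    (FF : Filter F) (f g : T -> G) (a b : G) :
  f x @[x --> F] --> a -> g x @[x --> F] --> b ->
  (f x * g x)%g @[x --> F] --> (a * b)%g.
Proof.
move=> fa gb.
have := cvg_comp (fun x => (f x, g x)) (fun x : G * G => (x.1 * x.2)%g).
by apply; [exact: cvg_pair fa gb|exact: (@mulg_continuous G (a, b))].
Qed.

Lemma sqrt_open_nbhs (G : topologicalGroupType) (U : set G) :
  nbhs (1%g : G) U ->
  exists V : set G, [/\ open_nbhs (1%g : G) V, forall x, V x -> V x^-1%g &
                        forall x y, V x -> V y -> U (x * y)%g].
Proof.
move=> U1.
have : nbhs ((1, 1)%g : G * G) ((fun x : G * G => (x.1 * x.2)%g) @^-1` U).
  by apply: (@mulg_continuous G (1, 1)%g); rewrite /= mulg1.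
case=> -[A B] /= [A1 B1] ABU.
pose W := A^° `&` B^°.
have oW : open W by apply: openI; exact: open_interior.
have W1 : W 1%g by split; exact: nbhs_singleton (nbhs_interior _).
exists (W `&` (fun x : G => x^-1%g) @^-1` W); split.
- split; last by split => //=; rewrite invg1.
  apply: openI => //; apply: open_comp => // x _; exact: invg_continuous.
- by move=> x [Wx Wx'] /=; split => //=; rewrite invgK.
- move=> x y [[/interior_subset Ax _] _] [[_ /interior_subset By] _].
  exact: (ABU (x, y)).
Qed.

(** * Dyadic products of a chain of neighbourhoods *)

Section DyadicChain.
Variables (G : topologicalGroupType) (U : nat -> set G).
Hypothesis U_1 : forall n, U n 1%g.
Hypothesis U_mul : forall n x y, U n.+1 x -> U n.+1 y -> U n (x * y)%g.

(* [dyadic n k] stands for a set indexed by the rational [k / 2 ^ n]. *)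
Fixpoint dyadic (n k : nat) : set G :=
  match n with
  | 0 => match k with 0 => [set 1%g] | 1 => U 0 | _ => setT end
  | m.+1 => if odd k then mulset (U m.+1) (dyadic m k./2) else dyadic m k./2
  end.

(** This is binary addition of one unit. For even [k], [x] becomes the new leftmost factor. For odd
    [k], it merges with the leftmost factor into one element of the next larger neighbourhood, which
    is carried to the level above. *)
Lemma dyadic_mul n k x y : U n x -> dyadic n k y -> dyadic n k.+1 (x * y)%g.
Proof.
elim: n k x y => [|n IH] k x y Ux /=.
  by case: k => [|[|k]] //= ->; rewrite mulg1.
rewrite uphalf_half; case: (odd k) => /=.
  by case=> u Uu [z zk <-]; rewrite mulgA; apply: IH => //; exact: U_mul.
by move=> yk; exists x => //; exists y.
Qed.

Lemma dyadic_le n k l : (k <= l)%N -> dyadic n k `<=` dyadic n l.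
Proof.
move=> /subnKC <-; elim: (l - k)%N => [|m IH]; first by rewrite addn0.
by move=> y /IH ym; rewrite addnS -[y]mul1g; exact: dyadic_mul.
Qed.

Lemma dyadic_double n k : dyadic n.+1 k.*2 = dyadic n k.
Proof. by rewrite /= odd_double doubleK. Qed.

Lemma dyadic_scale n m k : dyadic (n + m) (k * 2 ^ m) = dyadic n k.
Proof.
elim: m => [|m IH]; first by rewrite addn0 muln1.
by rewrite addnS expnS mulnCA mul2n dyadic_double.
Qed.

(** A factor from [U n] adds [2 ^ m] to an index at level [n + m], provided that the index is a
    multiple of [2 ^ m]. Rounding [k] up to such a multiple costs at most [2 ^ m - 1], hence the
    total [2 ^ m.+1 - 1]. The induction rounds one binary digit at a time. *)
Lemma dyadic_shift n m k x y : U n x -> dyadic (n + m) k y ->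
  dyadic (n + m) (k + (2 ^ m.+1).-1) (x * y)%g.
Proof.
move=> Ux; elim: m k y => [|m IH] k y.
  by rewrite addn0 addn1; exact: dyadic_mul.
have -> : (n + m.+1 = (n + m).+1)%N by rewrite addnS.
move=> yk; have : dyadic (n + m).+1 (uphalf k).*2 y.
  by apply: dyadic_le yk; rewrite uphalfK leq_addl.
rewrite dyadic_double => /IH; rewrite -dyadic_double; apply: dyadic_le.
rewrite doubleD uphalfK [in leqRHS]expnS mul2n.
by have := expn_gt0 2 m.+1; case: (2 ^ m.+1)%N => //= p _; case: (odd k); lia.
Qed.

End DyadicChain.

Local Open Scope ring_scope.

(** * The dyadic gauge of the distance to a set *)

Section DyadicGauge.
Variables (R : realType) (G : topologicalGroupType) (U : nat -> set G).
Hypothesis U_1 : forall n, U n 1%g.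
Hypothesis U_mul : forall n x y, U n.+1 x -> U n.+1 y -> U n (x * y)%g.
Variables (T : set G).
Hypothesis T0 : T !=set0.

Definition dyadic_values (x : G) : set R :=
  [set r | exists n k, mulset (dyadic U n k) T x /\ r = k%:R / 2 ^+ n].

Definition dyadic_gauge (x : G) : R := inf (dyadic_values x).

Lemma dyadic_values_neq0 x : dyadic_values x !=set0.
Proof.
(* At level 0 the index 2 stands for the whole group, so 2 is a value at every point. *)
have [t Tt] := T0; exists (2%:R / 2 ^+ 0), 0%N, 2%N; split => //.
by exists (x * t^-1)%g => //; exists t => //; rewrite mulgVK.
Qed.

Lemma dyadic_values_ge0 x : lbound (dyadic_values x) 0.
Proof. by move=> _ [n [k [_ ->]]]; rewrite divr_ge0// exprn_ge0. Qed.

Lemma dyadic_gauge_le n k x : mulset (dyadic U n k) T x ->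
  dyadic_gauge x <= k%:R / 2 ^+ n.
Proof.
move=> xk; apply: ge_inf; last by exists n, k.
by exists 0; exact: dyadic_values_ge0.
Qed.

Lemma dyadic_gauge_ge n k x : ~ mulset (dyadic U n k) T x ->
  k%:R / 2 ^+ n <= dyadic_gauge x.
Proof.
move=> xk; apply: lb_le_inf; first exact: dyadic_values_neq0.
move=> _ [m [l [[y yl [t Tt yt]] ->]]]; rewrite leNgt; apply/negP => lt_lk.
apply: xk; exists y => //; last by exists t.
(* Both indices are brought to the common level [n + m], where the sets increase with the index. *)
rewrite -(dyadic_scale U n m) addnC.
move: yl; rewrite -(dyadic_scale U m n) => /(dyadic_le U_1 U_mul); apply.
move: lt_lk; rewrite ltr_pdivrMr ?exprn_gt0// mulrAC ltr_pdivlMr ?exprn_gt0//.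
by rewrite -!natrX -!natrM ltr_nat => /ltnW.
Qed.

(** The increment from [dyadic_shift], divided by [2 ^ (n + m)], stays below [2 / 2 ^ n] whatever
    the level [m] of the value at [y]; the bound therefore passes to the infimum. *)
Lemma dyadic_gauge_shift n x y : U n (x * y^-1)%g ->
  dyadic_gauge x <= dyadic_gauge y + 2 / 2 ^+ n.
Proof.
move=> Uxy; rewrite -lerBlDr; apply: lb_le_inf.
  exact: dyadic_values_neq0.
move=> _ [m [k [[z zk [t Tt zt]] ->]]]; rewrite lerBlDr.
have : mulset (dyadic U (n + m) (k * 2 ^ n + (2 ^ m.+1).-1)) T x.
  exists (x * y^-1 * z)%g; last by exists t; rewrite // -mulgA zt mulgVK.
  by apply: (dyadic_shift U_1 U_mul) => //; rewrite addnC dyadic_scale.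
move/dyadic_gauge_le/le_trans; apply.
rewrite ler_pdivrMr ?exprn_gt0// mulrDl !exprD.
have -> : k%:R / 2 ^+ m * (2 ^+ n * 2 ^+ m) = (k * 2 ^ n)%:R :> R.
  by rewrite mulrCA divfK ?expf_neq0// mulrC natrM natrX.
have -> : 2 / 2 ^+ n * (2 ^+ n * 2 ^+ m) = (2 ^ m.+1)%:R :> R.
  by rewrite mulrA divfK ?expf_neq0// natrX exprS.
by rewrite -natrD ler_nat leq_add2l leq_pred.
Qed.

End DyadicGauge.

(** * Uniformly continuous bump functions *)

Lemma right_uniform_bump (R : realType) (G : topologicalGroupType) (U : set G) :
  nbhs (1%g : G) U ->
  exists V1 V2 : set G,
    [/\ open_nbhs (1%g : G) V1, open_nbhs (1%g : G) V2, closure V1 `<=` V2,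
        V2 `<=` U & forall T : set G, exists h : G -> R,
        [/\ forall x, 0 <= h x <= 1,
            forall eps, 0 < eps -> exists2 W : set G, nbhs (1%g : G) W &
              forall s t, W (s * t^-1)%g -> `|h s - h t| < eps,
            forall x, mulset V1 T x -> h x = 1 &
            forall x, ~ mulset V2 T x -> h x = 0]].
Proof.
move=> U1.
have /choice[F FP] : forall A : set G, exists V : set G, nbhs (1%g : G) A ->
    [/\ open_nbhs (1%g : G) V, forall x, V x -> V x^-1%g &
        forall x y, V x -> V y -> A (x * y)%g].
  move=> A; have [A1|] := pselect (nbhs (1%g : G) A); last by exists setT.
  by have [V ?] := @sqrt_open_nbhs G A A1; exists V.
pose W n := iter n.+1 F U.
have nW n : nbhs (1%g : G) (iter n F U).
  by elim: n => //= n /FP[/open_nbhs_nbhs].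
have W_1 n : W n 1%g := nbhs_singleton (nW n.+1).
have oW n : open_nbhs (1%g : G) (W n) by have [] := FP _ (nW n).
have WV n x : W n x -> W n x^-1%g by have [_ + _] := FP _ (nW n); exact.
have W_mul n x y : W n.+1 x -> W n.+1 y -> W n (x * y)%g.
  by have [_ _] := FP _ (nW n.+1); exact.
exists (W 1%N), (W 0%N); split => //.
(* A point [y] of [W 1] close enough to [x] gives [x = (x y^-1) y], a product of two elements of
   [W 1]. *)
- move=> x clx.
  have : nbhs x [set y | W 1%N (x * y^-1)%g].
    have cf : (x * y^-1)%g @[y --> x] --> (x * x^-1)%g.
      by apply: cvg_mulg; [exact: cvg_cst|exact: invg_continuous].
    apply: cf; rewrite /= mulgV; exact: (nW 2%N).
  by move=> /clx[y [Wy Wxy]]; rewrite -(mulgVK y x); exact: W_mul.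
- move=> x /= Wx; have [_ _ /(_ x 1%g Wx (W_1 0%N))] := FP _ U1.
  by rewrite mulg1.
(* The gauge would be an infimum over the empty set if [T] were empty; the zero function serves in
   that case. *)
move=> T; have [->|T0] := eqVneq T set0.
  exists (fun=> 0); split => //.
  - by move=> x; rewrite lexx ler01.
  - by move=> eps e0; exists setT => [|s t _];
      [exact: filterT|rewrite subrr normr0].
  - by move=> x [y _ []].
move/set0P: T0 => T0; pose p := @dyadic_gauge R G W T.
(* [W 1] and [W 0] are the dyadic sets of index 1/2 and 1, so [p] is at most 1/2 on [W 1 T] and at
   least 1 off [W 0 T]. The affine map [2 - 2 p] sends these bounds to 1 and 0. *)
exists (fun x => Num.min 1 (Num.max 0 (2 - 2 * p x))); split.
- by move=> x; rewrite le_min ler01 le_max lexx/= ge_min lexx.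
- move=> eps e0.
  (* The slope 2 of the truncation times the gauge increment [2 / 2 ^ n]. *)
  have [n ne] : exists n, 4 / 2 ^+ n < eps.
    have [n _] :=
      near_infty_natSinv_expn_lt (PosNum (divr_gt0 e0 (ltr0Sn R 3))).
    move=> /(_ n (leqnn n)); rewrite /= ltr_pdivlMr// mul1r mulrC => ?.
    by exists n.
  exists (W n); first exact: nW n.+1.
  move=> s t Wst; have Wts : W n (t * s^-1)%g.
    by rewrite -invgF; exact: WV.
  apply: le_lt_trans ne.
  have := dyadic_gauge_shift R W_1 W_mul T0 Wst.
  have := dyadic_gauge_shift R W_1 W_mul T0 Wts.
  rewrite -/p; have -> : 4 / 2 ^+ n = 2 * (2 / 2 ^+ n) :> R by lra.
  move: (2 / 2 ^+ n) => e; rewrite ler_norml /Num.min /Num.max.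
  move: (p s) (p t) => a b ab ba.
  by do 2 (case: (ltP 0 _) => ?; case: (ltP 1 _) => ?); apply/andP; split; lra.
- move=> x Wx; suff : p x <= 1 / 2 by move=> ?; rewrite max_r ?min_l; lra.
  apply: (@dyadic_gauge_le R G W T 1 1 x); case: Wx => v Wv [t Tt <-].
  exists v; last by exists t.
  by exists v => //; exists 1%g => //; rewrite mulg1.
- move=> x Wx; have : 1 / 2 ^+ 0 <= p x.
    exact: (@dyadic_gauge_ge R G W W_1 W_mul T T0 0 1).
  by move=> ?; rewrite max_l ?min_r; lra.
Qed.

(** * Complex-valued functions through real bounds and real and imaginary parts *)

Section ComplexValued.
Variable R : realType.

Lemma norm_real_complex (a : R) : `|(a%:C)%C : CC R| = (`|a|%:C)%C.
Proof. by rewrite normc_def/= expr0n/= addr0 sqrtr_sqr. Qed.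

Lemma gt0_CC (z : CC R) : 0 < z -> exists2 e : R, 0 < e & z = (e%:C)%C.
Proof.
by case: z => a b; rewrite ltcE/= => /andP[/eqP-> a0]; exists a.
Qed.

Lemma bounded_fun_CC (X : Type) (f : X -> CC R) :
  bounded_fun f <-> exists M : R, forall x, `|f x| <= (M%:C)%C.
Proof.
split=> [[M [Mr fM]]|[M fM]].
  (* Boundedness gives the inequality only for numbers strictly above [M], hence [M + 1]. *)
  exists (complex.Re (M + 1 : CC R)) => x.
  rewrite RRe_real; last by rewrite realD// real1.
  by apply: (fM (M + 1)) => //; rewrite ltrDl ltr01.
exists (M%:C)%C; split; first by apply/complex_realP; exists M.
by move=> y My x _; exact: le_trans (fM x) (ltW My).
Qed.

Lemma normc_ge_Im (z : CC R) : ((`|complex.Im z|)%:C)%C <= `|z|.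
Proof.
by rewrite normc_def lecR -sqrtr_sqr ler_wsqrtr// lerDr sqr_ge0.
Qed.

Lemma normci : `|'i%C : CC R| = 1.
Proof. by rewrite normc_def/= expr0n/= add0r expr1n sqrtr1. Qed.

Lemma continuous_complex (X : topologicalType) (a b : X -> R) :
  continuous a -> continuous b ->
  continuous (fun x => (a x +i* b x)%C : CC R).
Proof.
move=> ca cb x; apply/cvgrPdist_lt => _/gt0_CC[e e0 ->].
have /cvgrPdist_lt/(_ _ (divr_gt0 e0 (ltr0n R 2))) := ca x.
have /cvgrPdist_lt/(_ _ (divr_gt0 e0 (ltr0n R 2))) := cb x.
apply: filterS2 => y bxy axy /=.
have -> : ((a x +i* b x)%C - (a y +i* b y)%C : CC R)
    = (((a x - a y)%:C)%C : CC R) + ('i%C : CC R) * (((b x - b y)%:C)%C : CC R).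
  by rewrite [LHS]complexE.
apply: (le_lt_trans (ler_normD _ _)); rewrite normrM !norm_real_complex.
by rewrite normci mul1r -rmorphD ltcR; lra.
Qed.

Lemma set_type_extend (X : Type) (T : set X) (f : set_type T -> CC R) :
  exists F : X -> CC R, forall t, F (set_val t) = f t.
(* Outside [T], [insub] fails and the default value 0 is taken. *)
Proof. by exists (fun x => oapp f 0 (insub x)) => t; rewrite valK. Qed.

Lemma set_val_surj (X : Type) (T : set X) x : T x ->
  exists t : set_type T, set_val t = x.
Proof. by move=> Tx; exists (SigSub (mem_set Tx)). Qed.

End ComplexValued.

(** * Discreteness of interpolation sets *)

Lemma discrete_subsetP (X : topologicalType) (T : set X) :
  discrete_subset T <->
  forall x, T x -> exists2 U, nbhs x U & U `&` T `<=` [set x].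
Proof.
split=> [dT x Tx|dT t].
  have [t tx] := set_val_surj Tx; subst x.
  have : nbhs t [set t] by rewrite dT principal_filterP.
  rewrite nbhsE => -[_ [[V oV <-] Vt] Vsub].
  exists V; first by exists V.
  move=> y [Vy Ty]; have [s sy] := set_val_surj Ty; subst y.
  by rewrite (Vsub s Vy).
apply/seteqP; split => A.
  by move=> /nbhs_singleton; rewrite principal_filterP.
rewrite principal_filterP => At.
have [U nU Ut] := dT (set_val t) (set_valP t).
have : nbhs t (set_val @^-1` U).
  exact: (@initial_continuous _ _ (set_val : set_type T -> X) t U nU).
apply: filterS => s Us; suff -> : s = t by [].
by apply: val_inj; apply: Ut; split => //; exact: set_valP.
Qed.

(** Interpolate the indicator of a point [t] of [T]: the points where the extension differs by less
    than 1 from its value at [t] form a neighbourhood of [t] containing no other point of [T]. *)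
Lemma interpolation_discrete (R : realType) (G : topologicalGroupType)
    (A : set (G -> CC R)) (T : set G) :
  (forall f, A f -> continuous f) -> interpolation_set A T -> discrete_subset T.
Proof.
move=> cA iT; apply/discrete_subsetP => x Tx.
have [t tx] := set_val_surj Tx; subst x.
have [|g /cA cg gf] := iT (fun s => (s == t)%:R : CC R).
  apply/bounded_fun_CC; exists 1 => s.
  by case: (s == t); rewrite ?normr0 ?normr1 (ler01, lexx).
have /cvgrPdist_lt/(_ _ ltr01) := cg (set_val t).
move=> nU; exists [set y | `|g (set_val t) - g y| < 1] => // y [/= ty Ty].
have [s sy] := set_val_surj Ty; subst y.
move: ty; rewrite !gf eqxx; have [->//|_] := eqVneq s t.
by rewrite subr0 normr1 ltxx.
Qed.

(** * Approximability from uniformly continuous bumps *)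

Lemma LUC_CB (R : realType) (G : topologicalGroupType) : LUC R G `<=` CB R G.
Proof.
move=> f [bf uf]; split=> // x; apply/cvgrPdist_lt => eps e0.
have [U U1 fU] := uf _ e0.
have nU : nbhs x [set y | U (x * y^-1)%g].
  have cf : (x * y^-1)%g @[y --> x] --> (x * x^-1)%g.
    by apply: cvg_mulg; [exact: cvg_cst|exact: invg_continuous].
  by apply: cf; rewrite /= mulgV.
by apply: filterS nU => y /= Uxy; exact: fU.
Qed.

Lemma LUC_bump (R : realType) (G : topologicalGroupType) (U : set G) :
  nbhs (1%g : G) U ->
  exists V1 V2 : set G,
    [/\ open_nbhs (1%g : G) V1, open_nbhs (1%g : G) V2, closure V1 `<=` V2,
        V2 `<=` U & forall T : set G, exists2 h, LUC R G h &
          h @` mulset V1 T `<=` [set 1] /\ h @` (~` mulset V2 T) `<=` [set 0]].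
Proof.
move=> /(@right_uniform_bump R)[V1 [V2 [oV1 oV2 V12 V2U bump]]].
exists V1, V2; split => // T; have [h [h01 uh h1 h0]] := bump T.
exists (fun x => (h x)%:C%C : CC R); split.
- apply/bounded_fun_CC; exists 1 => x.
  by rewrite norm_real_complex lecR ger0_norm; have /andP[] := h01 x.
- move=> _/gt0_CC[e e0 ->]; have [W W1 hW] := uh _ e0.
  exists W => // s t /hW hst.
  by rewrite -rmorphB norm_real_complex ltcR.
- by move=> _ [x /h1 hx <-] /=; rewrite hx.
- by move=> _ [x /h0 hx <-] /=; rewrite hx.
Qed.

Lemma interpolation_approximable (R : realType) (G : topologicalGroupType)
    (A : set (G -> CC R)) (T : set G) :
  LUC R G `<=` A -> interpolation_set A T -> approximable_interpolation_set A T.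
Proof.
move=> LA iT; split => // U /(@LUC_bump R)[V1 [V2 [oV1 oV2 V12 V2U bump]]].
by exists V1, V2; split => // T1 _; have [h /LA] := bump T1; exists h.
Qed.

(** * Interpolation on closed discrete sets by Tietze's theorem *)

Lemma normal_closed_discrete_interpolation (R : realType)
    (G : topologicalGroupType) (T : set G) :
  normal_space G -> discrete_subset T -> closed T ->
  interpolation_set (CB R G) T.
Proof.
move=> nG /discrete_subsetP dT cT f /bounded_fun_CC[M fM].
have [F Ff] := set_type_extend f.
have FM x : T x -> `|F x| <= (M%:C)%C.
  by move=> Tx; have [t <-] := set_val_surj Tx; rewrite Ff.
(* Every function is continuous on a discrete set, so Tietze's theorem applies to the real and
   imaginary parts. *)
have cts (a : G -> R^o) : {within T, continuous a}.
  apply/subspace_continuousP => x Tx W /nbhs_singleton Wax.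
  have [U nU UT] := dT x Tx.
  by apply: filterS nU => y Uy Ty; rewrite /= (UT y (conj Uy Ty)).
have ext (a : G -> R^o) : (forall x, T x -> `|a x| <= M) ->
    exists b : G -> R^o,
      (* [M] may be 0, or even negative when [T] is empty; [|M| + 1] is a positive bound. *)
      [/\ {in T, a =1 b}, continuous b & forall x, `|b x| <= `|M| + 1].
  move=> aM; apply: (continuous_bounded_extension nG cT) => //.
  move=> x /aM ax; apply: (le_trans ax).
  by rewrite (le_trans (ler_norm M))// lerDl.
have [|a [Fa ca aM]] := ext (fun x => complex.Re (F x)).
  by move=> x /FM; rewrite -lecR; exact: le_trans (normc_ge_Re _).
have [|b [Fb cb bM]] := ext (fun x => complex.Im (F x)).
  by move=> x /FM; rewrite -lecR; exact: le_trans (normc_ge_Im _).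
exists (fun x => (a x +i* b x)%C : CC R).
  split; first exact: continuous_complex.
  apply/bounded_fun_CC; exists ((`|M| + 1) + (`|M| + 1)) => x.
  have -> : (a x +i* b x)%C
      = ((a x)%:C%C : CC R) + ('i%C : CC R) * ((b x)%:C%C : CC R).
    by rewrite [LHS]complexE.
  apply: (le_trans (ler_normD _ _)).
  by rewrite normrM normci mul1r !norm_real_complex -rmorphD lecR lerD.
move=> t; rewrite -Ff -Fa ?inE; last exact: set_valP.
rewrite -Fb ?inE; last exact: set_valP.
by case: (F _).
Qed.

(** * Finite sets in locally compact groups *)

Lemma locally_compact_nbhs1 (G : topologicalGroupType) :
  locally_compact [set: G] -> exists2 K : set G, nbhs (1%g : G) K & compact K.
Proof.
move=> /(_ 1%g I)[K nK [cK _]]; exists K => //.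
by move: nK; rewrite /within/=; apply: filterS => x; exact.
Qed.

Lemma C0_approximable (R : realType) (G : topologicalGroupType) (T : set G) :
  locally_compact [set: G] -> finite_set T -> forall U, nbhs (1%g : G) U ->
  exists V1 V2 : set G,
    [/\ open_nbhs (1%g : G) V1, open_nbhs (1%g : G) V2, closure V1 `<=` V2,
        V2 `<=` U & forall T1 : set G, T1 `<=` T -> exists2 h, C0 R G h &
          h @` mulset V1 T1 `<=` [set 1] /\
          h @` (~` mulset V2 T1) `<=` [set 0]].
Proof.
move=> /locally_compact_nbhs1[K nK cK] fT U nU.
have [V1 [V2 [oV1 oV2 V12 V2U bump]]] := @LUC_bump R G _ (filterI nU nK).
exists V1, V2; split => //; first by move=> x /V2U[].
move=> T1 T1T; have [h Lh [h1 h0]] := bump T1; exists h => //.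
(* Since [V2] lies in [K], [h] vanishes off [K T1], which is compact as the image of [K] times a
   finite set under multiplication. *)
have [ch _] := LUC_CB Lh; split => // eps e0; exists (mulset K T1).
  have : compact ((fun x : G * G => (x.1 * x.2)%g) @` (K `*` T1)).
    apply: continuous_compact.
      by apply: continuous_subspaceT; exact: mulg_continuous.
    apply: compact_setX => //; apply: finite_compact.
    exact: sub_finite_set fT.
  congr compact; apply/seteqP; split => x.
    by move=> [[a b] [/= Ka Tb] <-]; exists a => //; exists b.
  by move=> [a Ka [b Tb <-]]; exists (a, b).
move=> x Kx; have -> : h x = 0.
  apply: h0; exists x => // -[v V2v [t Tt vt]]; apply: Kx.
  by exists v; [have [] := V2U _ V2v|exists t].
by rewrite normr0.
Qed.

(** Points are added one at a time: a multiple of a bump at the new point that vanishes at the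
    earlier ones corrects the value there and leaves the others unchanged. *)
Lemma finite_C0_interpolation (R : realType) (G : topologicalGroupType)
    (T : set G) : hausdorff_space G -> locally_compact [set: G] ->
  finite_set T -> interpolation_set (C0 R G) T.
Proof.
move=> hG lG fT f _; have [F Ff] := set_type_extend f.
suff [g Cg gF] : exists2 g, C0 R G g & forall x, T x -> g x = F x.
  by exists g => // t; rewrite gF ?Ff//; exact: set_valP.
have closedT := accessible_finite_set_closed.1 (hausdorff_accessible hG).
move/finite_seqP: fT => [s ->]; elim: s => [|x s [g [cg g0] gF]].
  exists (fun=> 0) => //; split; first by move=> x; exact: cvg_cst.
  by move=> e e0; exists set0; [exact: compact0|move=> x _; rewrite normr0].
have [xs|xs] := boolP (x \in s).
  by exists g => // y /=; rewrite inE => /orP[/eqP->|]; exact: gF.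
(* A neighbourhood of the identity whose translate to [x] misses the finite, hence closed, set of
   earlier points. *)
have nU : nbhs (1%g : G) [set v | ~ [set` s] (v * x)%g].
  have cm : (v * x)%g @[v --> (1%g : G)] --> (1 * x)%g.
    by apply: cvg_mulg; [exact: cvg_id|exact: cvg_cst].
  apply: (cm (~` [set` s])); apply: open_nbhs_nbhs; split.
    by apply: closed_openC; apply: closedT; exact: finite_seq.
  by rewrite mul1g; exact/negP.
have [V1 [V2 [[_ V11] _ _ V2U bump]]] :=
  @C0_approximable R G [set x] lG (finite_set1 x) _ nU.
have [h [ch h0] [hx hs]] := bump [set x] (fun _ => id).
have {}hx : h x = 1.
  by apply: hx; exists x => //; exists 1%g => //; exists x; rewrite ?mul1g.
have {}hs y : y \in s -> h y = 0.
  move=> ys; apply: hs; exists y => // -[v /V2U Vv [_ -> vy]].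
  by apply: Vv; rewrite /= vy.
pose c := F x - g x; exists (fun y => g y + c * h y); last first.
  move=> y /=; rewrite inE => /orP[/eqP->|ys].
    by rewrite hx mulr1 addrC subrK.
  by rewrite hs// mulr0 addr0 gF.
split.
  move=> y; apply: cvgD; first exact: cg.
  by apply: cvgM; [exact: cvg_cst|exact: ch].
(* The term 1 keeps the divisor positive when [c] is 0. *)
move=> e e0; have c0 : 0 < `|c| + 1 by rewrite ltr_wpDl.
have [K cK Kg] := g0 _ (divr_gt0 e0 (ltr0n (CC R) 2)).
have [L cL Lh] := h0 _ (divr_gt0 (divr_gt0 e0 (ltr0n (CC R) 2)) c0).
exists (K `|` L); first exact: compactU.
move=> y /not_orP[/Kg gy /Lh hy]; rewrite [ltRHS]splitr.
apply: (le_lt_trans (ler_normD _ _)); apply: ltr_leD => //.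
rewrite normrM; apply: le_trans (_ : (`|c| + 1) * `|h y| <= _).
  by rewrite ler_wpM2r// lerDl.
by rewrite mulrC -ler_pdivlMr//; exact: ltW.
Qed.

(** * Metrizable groups *)

Lemma metrizable_normal (R : realType) (X : topologicalType) :
  metrizable R X -> normal_space X.
Proof.
move=> [d [dE dC dT dN]] A cA O AO.
have ball_nbhs x e : 0 < e -> nbhs x [set y | d x y < e].
  by move=> e0; rewrite dN; exists e.
have /choice[r rP] : forall a, exists e : R, A a ->
    0 < e /\ [set y | d a y < e] `<=` O.
  move=> a; have [Aa|] := pselect (A a); last by exists 0.
  by have := AO _ Aa; rewrite dN => -[e e0 eO]; exists e.
(* Balls of half the admissible radius leave room for the closure of their union to stay in [O]. *)
pose V := \bigcup_(a in A) [set y | d a y < r a / 2].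
exists V.
  move=> a Aa; have [r0 _] := rP a Aa.
  by apply: filterS (ball_nbhs a _ (divr_gt0 r0 (ltr0n R 2))) => y; exists a.
move=> y Vy; have [Ay|nAy] := pselect (A y).
  by exact: nbhs_singleton (AO _ Ay).
have : nbhs y (~` A) by apply: open_nbhs_nbhs; split; [exact: closed_openC|].
rewrite dN => -[s s0 sA].
have [z [[a Aa /= az] /= yz]] := Vy _ (ball_nbhs y _ (divr_gt0 s0 (ltr0n R 2))).
have [r0 rO] := rP a Aa.
have ay : d a y < (r a + s) / 2.
  by apply: le_lt_trans (dT a z y) _; rewrite (dC z y); lra.
(* The mean of [r a] and [s] is at most their maximum: either [y] lies in the ball about [a] inside
   [O], or [a] lies in the ball about [y] that misses [A]. *)
have [rs|sr] := leP s (r a); first by apply: rO => /=; lra.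
by exfalso; apply: (sA a) => //=; rewrite dC; lra.
Qed.

Lemma metrizable_interpolation_closed (R : realType)
    (G : topologicalGroupType) (A : set (G -> CC R)) (T : set G) :
  metrizable R G -> (forall f, A f -> continuous f) ->
  interpolation_set A T -> closed T.
Proof.
move=> [d [dE dC dT dN]] cA iT x clx; apply: contrapT => nTx.
have ball_nbhs e : 0 < e -> nbhs x [set y | d x y < e].
  by move=> e0; rewrite dN; exists e.
have d0 y : T y -> 0 < d x y.
  move=> Ty; rewrite lt_neqAle; apply/andP; split.
    by apply: contra_notN nTx => /eqP/esym/dE ->.
  by have := dT x y x; rewrite (dC y x) (dE x x).2//; lra.
have /choice[F FP] : forall e : R, exists y, 0 < e -> T y /\ d x y < e.
  move=> e; have [e0|] := ltP 0 e; last by exists x.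
  by have [y [Ty xy]] := clx _ (ball_nbhs e e0); exists y.
(* Points of [T] approaching [x] at strictly decreasing distances, hence
   distinct: a function alternating along them has no limit at [x]. *)
pose u := fix u n := if n is m.+1 then F (Num.min (d x (u m)) m.+1%:R^-1)
                     else F 1.
have Tu n : T (u n).
  elim: n => [|n IH] /=; first by have [] := FP 1 ltr01.
  by apply: (FP _ _).1; rewrite lt_min d0//= invr_gt0 ltr0n.
(* The first bound makes the distances strictly decreasing, the second makes them tend to 0. *)
have uS n : d x (u n.+1) < Num.min (d x (u n)) n.+1%:R^-1.
  by apply: (FP _ _).2; rewrite lt_min d0//= invr_gt0 ltr0n.
have du : {homo (fun n => d x (u n)) : m n / (m < n)%N >-> n < m}.
  apply: homo_ltn => [a b c ab bc|n]; first exact: lt_trans bc ab.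
  by have := uS n; rewrite lt_min => /andP[].
have uI : injective u.
  by move=> m n mn; have [/du|/du|//] := ltngtP m n; rewrite mn ltxx.
pose S := [set u n.*2 | n in setT].
have [|g /cA cg gf] := iT (fun t => (set_val t \in S)%:R : CC R).
  apply/bounded_fun_CC; exists 1 => t.
  by case: (_ \in S); rewrite ?normr0 ?normr1 (ler01, lexx).
have gu n : g (u n) = (u n \in S)%:R.
  by have [t <-] := set_val_surj (Tu n); rewrite gf.
have g1 n : g (u n.*2) = 1 by rewrite gu mem_set//; exists n.
have g0 n : g (u n.*2.+1) = 0.
  rewrite gu memNset// => -[m _ /uI/(congr1 odd)] /=.
  by rewrite !odd_double.
have /cvgrPdist_lt/(_ _ (divr_gt0 ltr01 (ltr0n (CC R) 2))) := cg x.
rewrite /prop_near1 dN => -[e e0 eg].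
have [n] := ltr_add_invr e0; rewrite add0r => ne.
have un k : (n < k)%N -> d x (u k) < e.
  case: k => // k; rewrite ltnS => nk; apply: lt_trans (uS k) _.
  rewrite gt_min; apply/orP; right; apply: le_lt_trans ne.
  by rewrite lef_pV2 ?posrE ?ltr0n// ler_nat.
(* Two consecutive indices beyond [n], one even and one odd, put [g x] within 1/2 of both 1 and
   0. *)
have a1 : `|g x - g (u n.+1.*2)| < 1 / 2 by apply: eg; apply: un; lia.
have a0 : `|g x - g (u n.+1.*2.+1)| < 1 / 2 by apply: eg; apply: un; lia.
move: a1 a0; rewrite g1 g0 subr0 => a1 a0.
have := ltrD a0 a1; rewrite -splitr => /(le_lt_trans (ler_normB _ _)).
by rewrite opprB addrC subrK normr1 ltxx.
Qed.

(** Compactness is used in its near-covering form, with the filter generated by the supersets of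
    finite sets. Each point of [K] has a neighbourhood meeting [T] in at most that point, so locally
    [T] is contained in all sufficiently large [B]; compactness makes this uniform over [K], and a
    finite [B] then contains [T]. *)
Lemma compact_discrete_closed_finite (X : topologicalType) (K T : set X) :
  compact K -> T `<=` K -> discrete_subset T -> closed T -> finite_set T.
Proof.
move=> /compact_near_coveringP cK TK /discrete_subsetP dT cT.
pose F := filter_from [set A : set X | finite_set A]
                      (fun A => [set B | A `<=` B]).
have FF : Filter F.
  apply: filter_from_filter; first by exists set0; exact: finite_set0.
  move=> A B fA fB; exists (A `|` B); first by rewrite /= finite_setU.
  by move=> C; rewrite /= subUset.
have [|A fA AT] := cK _ F (fun B x => T x -> B x) FF.
  move=> x Kx; have [Tx|nTx] := pselect (T x).
    have [U nU UT] := dT x Tx.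
    exists (U, [set B | [set x] `<=` B]) => /=.
      by split => //; exists [set x] => //; exact: finite_set1.
    by move=> [y B] /= [Uy xB] Ty; apply: xB; rewrite (UT y (conj Uy Ty)).
  exists (~` T, setT) => /=.
    split; last exact: filterT.
    by apply: open_nbhs_nbhs; split; [exact: closed_openC|].
  by move=> [y B] /= [].
apply: (sub_finite_set _ fA) => x Tx; apply: (AT A _ x) => //.
exact: TK.
Qed.

Theorem proposition3p3 (R : realType) (G : topologicalGroupType)
    (hG : hausdorff_space G) :
  (forall A : set (G -> CC R), A `<=` CB R G ->
     forall T : set G, interpolation_set A T -> discrete_subset T) /\
  ((forall T : set G, interpolation_set (CB R G) T ->
      approximable_interpolation_set (CB R G) T) /\
   (forall T : set G, interpolation_set (LUC R G) T ->
      approximable_interpolation_set (LUC R G) T)) /\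
  (normal_space G ->
     forall T : set G, discrete_subset T -> closed T ->
       approximable_interpolation_set (CB R G) T) /\
  (locally_compact [set: G] ->
     forall T : set G, finite_set T ->
       approximable_interpolation_set (C0 R G) T) /\
  (metrizable R G ->
     forall T : set G,
       approximable_interpolation_set (CB R G) T <->
       (discrete_subset T /\ closed T)) /\
  (locally_compact [set: G] -> metrizable R G ->
     forall T : set G,
       approximable_interpolation_set (C0 R G) T <-> finite_set T).
Proof.
have CB_cont (f : G -> CC R) : CB R G f -> continuous f by case.
have C0_cont (f : G -> CC R) : C0 R G f -> continuous f by case.
have normalP : normal_space G -> forall T : set G, discrete_subset T ->
    closed T -> approximable_interpolation_set (CB R G) T.
  move=> nG T dT cT; apply: interpolation_approximable; first exact: LUC_CB.
  exact: normal_closed_discrete_interpolation.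
have finiteP : locally_compact [set: G] -> forall T : set G, finite_set T ->
    approximable_interpolation_set (C0 R G) T.
  move=> lG T fT; split; first exact: finite_C0_interpolation.
  exact: C0_approximable.
split; first by move=> A ACB T; apply: interpolation_discrete => f /ACB/CB_cont.
split.
  split=> T; apply: interpolation_approximable => //; exact: LUC_CB.
do 2 split => //; split.
  move=> mG T; split=> [[iT _]|[dT cT]].
    split; first exact: interpolation_discrete CB_cont iT.
    exact: metrizable_interpolation_closed mG CB_cont iT.
  exact: normalP (metrizable_normal mG) T dT cT.
move=> lG mG T; split=> [[iT _]|]; last exact: finiteP.
have dT := interpolation_discrete C0_cont iT.
have cT := metrizable_interpolation_closed mG C0_cont iT.
(* A function vanishing at infinity that equals 1 on [T] has modulus below 1 off some compact set,
   which must therefore contain [T]. *)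
have [|g [_ g0] gT] := iT (fun=> 1).
  by apply/bounded_fun_CC; exists 1 => t; rewrite normr1.
have [K cK Kg] := g0 _ ltr01.
apply: (compact_discrete_closed_finite cK _ dT cT) => x Tx.
apply: contrapT => /Kg; have [t <-] := set_val_surj Tx.
by rewrite gT normr1 ltxx.
Qed.
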